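(* In the two-period model with a secret bailout at price $p_g>p_0$ (i.e., $t=2$ buyers cannot observe which firms accepted the government offer), in equilibrium firms accept the government offer at $t=1$ if and only if $\theta<p_g+S$, and at $t=2$ firms sell assets to the market at price $p_0$ if and only if $\theta<\theta_0$.
   Context: Two-period model: a continuum of firms with privately known type $\theta\in[0,1]$, cdf $F$, density $f>0$, $f$ strictly log-concave, and for every $b\in(0,1]$ the map $a\mapsto 2\mathbb{E}[\theta\mid a<\theta<b]-\mathbb{E}[\theta\mid\theta\le a]$ is increasing on $(0,b)$. A type-$\theta$ firm holds one unit of an asset worth $\theta$ in each of two periods $t=1,2$. In each period it has a project with cost $I>0$ and net return $S>0$ that can be funded only by selling that period's unit; selling that unit at price $p\ge I$ yields $p+S$ for that period, not selling yields $\theta$. A firm's total payoff is the sum of the two periods' payoffs (period-2 payoff weighted by $\delta<1$, and equilibria are considered in the limit $\delta\to1$). In each period competitive short-lived risk-neutral buyers make price offers (Bertrand; break even in expectation; indifferent buyers buy). At $t=1$ only, the government offers to buy one unit at price $p_g$; each firm then sells its $t=1$ unit to the government, to the market, or not at all. Sales to the market at $t=1$ are not observed by $t=2$ buyers. Equilibrium means perfect Bayesian equilibrium. Laissez-faire: $\theta_0\in(0,1)$ uniquely solves $\theta_0-S=\mathbb{E}[\theta\mid\theta\le\theta_0]$, $p_0:=\mathbb{E}[\theta\mid\theta\le\theta_0]$, and $p_0\ge I$. Secret bailout: the acceptance of the government offer is also unobserved by $t=2$ buyers.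
   Formalization: Firms indifferent between the government and the market are assumed to sell to the government (otherwise some could sell to the market at p_g), and the indifferent cutoff types θ=p_g+S and θ=θ_0 are excluded from the two equivalences. *)

(* Defs.v *)
From HB Require Import structures.
From mathcomp Require Import all_boot all_order all_algebra.
From mathcomp Require Import all_classical all_reals all_analysis.
Set Implicit Arguments. Unset Strict Implicit. Unset Printing Implicit Defensive.
Import Order.TTheory GRing.Theory Num.Theory.
Import numFieldNormedType.Exports.
Local Open Scope classical_set_scope.
Local Open Scope ring_scope.

Definition tmass {R : realType} (f : R -> R) (A : set R) : R :=
  Rintegral (@lebesgue_measure R) (A `&` `[(0%R:R), 1%R]) f.

Definition tmoment {R : realType} (f : R -> R) (A : set R) : R :=
  Rintegral (@lebesgue_measure R) (A `&` `[(0%R:R), 1%R]) (fun x => x * f x).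

Definition condE {R : realType} (f : R -> R) (A : set R) : R :=
  tmoment f A / tmass f A.

Definition is_density {R : realType} (f : R -> R) : Prop :=
  measurable_fun `[(0%R:R), 1%R] f /\
  (forall x, 0 <= x <= 1 -> 0 < f x) /\
  (\int[@lebesgue_measure R]_(x in `[(0%R:R), 1%R]) (f x)%:E = 1)%E.

Definition strictly_log_concave {R : realType} (f : R -> R) : Prop :=
  forall x y t, 0 <= x <= 1 -> 0 <= y <= 1 -> x != y -> 0 < t < 1 ->
    t * ln (f x) + (1 - t) * ln (f y) < ln (f (t * x + (1 - t) * y)).

Definition monotone_condition {R : realType} (f : R -> R) : Prop :=
  forall b, 0 < b <= 1 -> forall a a', 0 < a -> a < a' -> a' < b ->
    2 * condE f `]a, b[ - condE f `]-oo, a]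
    < 2 * condE f `]a', b[ - condE f `]-oo, a'].

Definition laissez_faire_cutoff {R : realType} (f : R -> R) (S theta0 : R) : Prop :=
  0 < theta0 < 1 /\ theta0 - S = condE f `]-oo, theta0] /\
  (forall x, 0 < x < 1 -> x - S = condE f `]-oo, x] -> x = theta0).

(* one-period payoff of a firm selling its unit at price p: the project (cost I,
   net return S) is funded iff p >= I *)
Definition sale_payoff {R : realType} (I S p : R) : R := if I <= p then p + S else p.

Inductive act1 := Gov | Mkt | Keep.

Definition u1 {R : realType} (I S pg : R) (theta : R) (a : act1) (pm : R) : R :=
  match a with
  | Gov => sale_payoff I S pg
  | Mkt => sale_payoff I S pm
  | Keep => theta
  end.

Definition u2 {R : realType} (I S : R) (theta : R) (b : bool) (p : R) : R :=
  if b then sale_payoff I S p else theta.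

(** * Perfect Bayesian equilibrium under a secret bailout

   Strategies:
   - sigma1 theta p : t = 1 choice of type theta when the best market offer is p;
   - sigma2 theta a p : t = 2 sale decision of type theta, with own t = 1 action a,
     when the best t = 2 market offer is p.
   Equilibrium prices p1 (t = 1) and p2 (t = 2).  Since t = 2 buyers observe neither
   market sales nor acceptance of the government offer, their information set is
   trivial, their belief is the prior, and p2 does not depend on the history. *)

Definition U1 {R : realType} (I S pg delta p2 : R) (sigma2 : R -> act1 -> R -> bool)
  (theta : R) (a : act1) (p : R) : R :=
  u1 I S pg theta a p + delta * u2 I S theta (sigma2 theta a p2) p2.

Definition sellers1 {R : realType} (sigma1 : R -> R -> act1) (p : R) : set R :=
  [set theta | sigma1 theta p = Mkt].

Definition sellers2 {R : realType} (sigma1 : R -> R -> act1)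
  (sigma2 : R -> act1 -> R -> bool) (p1 p : R) : set R :=
  [set theta | sigma2 theta (sigma1 theta p1) p].

Definition bprofit {R : realType} (f : R -> R) (A : set R) (p : R) : R :=
  Rintegral (@lebesgue_measure R) (A `&` `[(0%R:R), 1%R]) (fun x => (x - p) * f x).

(* competitive (Bertrand) pricing with indifferent buyers buying: at the equilibrium
   price buyers break even, and no buyer can attract trade at a higher price without
   making a strict loss (a zero-profit higher offer with trade would be made). *)
Definition bertrand {R : realType} (f : R -> R) (sellers : R -> set R) (p : R) : Prop :=
  bprofit f (sellers p) p = 0 /\
  forall p', p < p' ->
    bprofit f (sellers p') p' < 0 \/ tmass f (sellers p') = 0.

Definition secret_bailout_eq {R : realType} (f : R -> R) (I S delta pg : R)
  (p1 p2 : R) (sigma1 : R -> R -> act1) (sigma2 : R -> act1 -> R -> bool) : Prop :=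
  (forall theta a p b, 0 <= theta <= 1 ->
     u2 I S theta b p <= u2 I S theta (sigma2 theta a p) p) /\
  (forall theta p a, 0 <= theta <= 1 ->
     U1 I S pg delta p2 sigma2 theta a p <= U1 I S pg delta p2 sigma2 theta (sigma1 theta p) p) /\
  (* tie-breaking: a firm indifferent between government and market sells to the government *)
  (forall theta p, 0 <= theta <= 1 -> sigma1 theta p = Mkt ->
     U1 I S pg delta p2 sigma2 theta Gov p < U1 I S pg delta p2 sigma2 theta Mkt p) /\
  bertrand f (sellers1 sigma1) p1 /\
  bertrand f (sellers2 sigma1 sigma2 p1) p2.

(* Main.v *)
Require Import Defs.
From HB Require Import structures.
From mathcomp Require Import all_boot all_order all_algebra.
From mathcomp Require Import all_classical all_reals all_analysis.
From mathcomp Require Import measurable_realfun ring lra.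
Import Order.TTheory GRing.Theory Num.Theory.
Import numFieldNormedType.Exports.
Local Open Scope classical_set_scope.
Local Open Scope ring_scope.

(* At t = 2 buyers learn nothing about past actions, so the continuation value of
   a firm does not depend on what it did at t = 1: both periods are static,
   whatever delta.  At a market price p >= I all types below p + S sell, and
   buyers earn (E[theta | theta <= p + S] - p) F(p + S).  Log-concavity makes
   x - E[theta | theta <= x] nondecreasing; since it equals S only at theta0 on
   (0, 1), it exceeds S on (theta0, 1], so buyers lose at every price p > p0.
   Hence p0 is the only competitive price at t = 2, while at t = 1 no market
   price above pg > p0 breaks even and every type below pg + S turns to the
   government. *)

Local Notation mu := lebesgue_measure.

(** * Translation invariance of Lebesgue integrals *)

Lemma measurable_shift {R : realType} (d : R) :
  measurable_fun setT (+%R^~ d : measurableTypeR R -> measurableTypeR R).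
Proof. exact: measurable_funD. Qed.

(** A translation preserves the length of half-open intervals, and these determine Lebesgue
    measure. *)
Lemma pushforward_shift {R : realType} (d : R) (A : set R) : measurable A ->
  pushforward mu (+%R^~ d : _ -> measurableTypeR R) A =
  mu A.
Proof.
move=> mA; apply/esym/lebesgue_measure_unique => //=.
  exact: measurable_shift.
move=> _ _ [[a b]] _ <-.
rewrite /pushforward (_ : _ @^-1` _ = `]a - d, b - d]%classic); last first.
  by apply/seteqP; split => x /=; rewrite !in_itv/= ltrBlDr lerBrDr.
rewrite !lebesgue_measure_itv/= !lte_fin ltrD2r.
case: ifPn => // _; rewrite -!EFinB; congr EFin; ring.
Qed.

Lemma integrable_shift {R : realType} (d : R) (g : R -> \bar R) :
  mu.-integrable setT g ->
  mu.-integrable setT (fun u => g (u + d)).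
Proof.
move=> /integrableP[mg ig]; apply/integrableP; split.
  exact: (measurableT_comp mg (measurable_shift d)).
apply: le_lt_trans ig.
rewrite -(preimage_setT (+%R^~ d : measurableTypeR R -> measurableTypeR R)).
rewrite -(ge0_integral_pushforward (measurable_shift d) _ measurableT
  (f := abse \o g))//=; last exact: measurableT_comp.
rewrite le_eqVlt; apply/orP; left; apply/eqP.
apply: eq_measure_integral => [|md A mA _]; first exact: measurable_shift.
exact: pushforward_shift.
Qed.

(** Serves to compare truncated means at two different cutoffs: after the shift both are integrals
    over the same half-line. *)
Lemma Rintegral_shift {R : realType} (d x : R) (g : R -> R) :
  mu.-integrable setT (EFin \o g) ->
  \int[mu]_(u in `]-oo, x + d]) g u =
  \int[mu]_(u in `]-oo, x]) g (u + d).
Proof.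
move=> ig; congr fine.
have -> : `]-oo, x]%classic =
    (+%R^~ d : measurableTypeR R -> measurableTypeR R) @^-1` `]-oo, x + d].
  by apply/seteqP; split => u /=; rewrite !in_itv/= lerD2r.
rewrite -(integral_pushforward (measurable_shift d) (f := EFin \o g))//=.
- apply: eq_measure_integral => [|md A mA _]; first exact: measurable_shift.
  exact/esym/pushforward_shift.
- exact: measurable_int ig.
- apply: (integrableS measurableT) => //; last exact: integrable_shift ig.
  rewrite -[X in measurable X]setTI.
  by apply: (measurable_shift d) => //; exact: measurable_itv.
Qed.

(** * Mass, conditional mean and buyers' profit under the type density *)

Section density.
Context {R : realType} {f : R -> R}.
Hypothesis df : is_density f.

Lemma density_gt0 x : 0 <= x <= 1 -> 0 < f x.
Proof. by have [_ [+ _]] := df; apply. Qed.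

Lemma density_integrable : mu.-integrable `[0, 1] (EFin \o f).
Proof.
have [mf [f0 intf]] := df; apply/integrableP; split.
  exact/measurable_EFinP.
rewrite [X in (X < _)%E](_ : _ = 1%E) ?ltry// -intf; apply: eq_integral => x.
by rewrite inE/= in_itv/= => /f0 fx /=; rewrite ger0_norm// ltW.
Qed.

Let bounded01 (g : R -> R) : (forall x, 0 <= x <= 1 -> `|g x| <= 1) ->
  [bounded g x | x in `[0, 1]%classic].
Proof.
move=> g1; exists 1; split => // M M1 x /=; rewrite in_itv/= => x01.
exact: le_trans (g1 _ x01) (ltW M1).
Qed.

Lemma moment_integrable : mu.-integrable `[0, 1] (EFin \o (fun x => x * f x)).
Proof.
rewrite [X in _.-integrable _ X](_ : _ =
  ((EFin \o (fun x => x)) \* (EFin \o f))%E)//.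
apply: integrableMr density_integrable => //.
by apply: bounded01 => x /andP[x0 x1]; rewrite ger0_norm.
Qed.

Lemma extension_integrable (g : R -> R) : mu.-integrable `[0, 1] (EFin \o g) ->
  mu.-integrable setT (EFin \o (g \_ `[0, 1])).
Proof.
move=> gi; rewrite -restrict_EFin.
have [+ _] := @integrable_mkcond _ _ _ mu `[0, 1]%classic (EFin \o g)
  (measurable_itv _).
exact.
Qed.

Lemma bprofitE (A : set R) p : measurable A ->
  bprofit f A p = tmoment f A - p * tmass f A.
Proof.
move=> mA; have mAI : measurable (A `&` `[0, 1]) by exact: measurableI.
have sub g : mu.-integrable `[0, 1] (EFin \o g) ->
    mu.-integrable (A `&` `[0, 1]) (EFin \o g).
  by apply: integrableS => //; exact: subIsetr.
have fi := sub _ density_integrable; have xfi := sub _ moment_integrable.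
rewrite /bprofit /tmoment /tmass -RintegralZl//.
rewrite -RintegralB//; first by apply: eq_Rintegral => x _; ring.
rewrite [X in _.-integrable _ X](_ : _ = (fun x => p%:E * (EFin \o f) x)%E)//.
exact: integrableZl.
Qed.

(** Optimality leaves the indifferent type [c] free, so a set of sellers is known only off [c].
    Deleting this null point makes both domains equal, which also yields the measurability of [A] on
    the unit interval. *)
Lemma Rintegral_cutoff (g : R -> R) (A : set R) c :
  measurable_fun (`[0, 1]%classic : set R) g ->
  (forall x, 0 <= x <= 1 -> x != c -> A x <-> x < c) ->
  \int[mu]_(x in A `&` `[0, 1]) g x = \int[mu]_(x in `]-oo, c] `&` `[0, 1]) g x.
Proof.
move=> mg Ac; rewrite /Rintegral; congr fine.
have mB : measurable ((`]-oo, c] `&` `[0, 1]) `\ c).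
  by apply: measurableD => //; exact: measurableI.
have AB : (A `&` `[0, 1]) `\ c = (`]-oo, c] `&` `[0, 1]) `\ c.
  apply/seteqP; split => x [[/= Ax x01] /eqP xc]; (split; last exact/eqP);
    split => //; move: (Ac x); rewrite /= in_itv/= in x01 *.
    by move=> /(_ x01 xc)[/(_ Ax)/ltW].
  by rewrite in_itv/= le_eqVlt (negbTE xc) in Ax => /(_ x01 xc)[_]; exact.
have mgB : measurable_fun ((`]-oo, c] `&` `[0, 1]) `\ c) (EFin \o g).
  by apply/measurable_EFinP; apply: measurable_funS mg => // x [[]].
by rewrite -(integral_setD1 (r := c)) AB// integral_setD1.
Qed.

Lemma bprofit_cutoff (A : set R) c p :
  (forall x, 0 <= x <= 1 -> x != c -> A x <-> x < c) ->
  bprofit f A p = bprofit f `]-oo, c] p.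
Proof.
apply: Rintegral_cutoff; apply: measurable_funM; first exact: measurable_funB.
by have [] := df.
Qed.

Lemma tmass_cutoff (A : set R) c :
  (forall x, 0 <= x <= 1 -> x != c -> A x <-> x < c) ->
  tmass f A = tmass f `]-oo, c].
Proof. by apply: Rintegral_cutoff; have [] := df. Qed.

(** A positive function with zero integral lives on a negligible domain, but this one contains an
    interval of length [Num.min c 1]. *)
Lemma tmass_gt0 c : 0 < c -> 0 < tmass f `]-oo, c].
Proof.
move=> c0; rewrite lt_neqAle Rintegral_ge0 ?andbT; last first.
  by move=> x [_ /=]; rewrite in_itv/= => /density_gt0/ltW.
apply/eqP => tm0.
pose D : set R := `]-oo, c] `&` `[0, 1].
have mD : measurable D by exact: measurableI.
have fiD : mu.-integrable D (EFin \o f).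
  by apply: integrableS density_integrable => //; exact: subIsetr.
have f0 : (\int[mu]_(x in D) `|(EFin \o f) x| = 0)%E.
  rewrite [RHS](_ : _ = (tmass f `]-oo, c])%:E); last by rewrite -tm0.
  rewrite /tmass /Rintegral fineK; last exact: integrable_fin_num.
  apply: eq_integral => x; rewrite inE => -[_ /=]; rewrite in_itv/= => x01.
  by rewrite ger0_norm// ltW// density_gt0.
have : mu.-negligible D.
  move/ae_eq_integral_abs : f0 => /(_ mD (measurable_int _ fiD)).
  apply: negligibleS => x Dx /= /(_ Dx) [] fx0.
  have : 0 < f x by apply: density_gt0; case: Dx => _ /=; rewrite in_itv.
  by rewrite fx0 ltxx.
move/measure_negligible => /(_ mD) D0.
have : (mu `[0%R, Num.min c 1%R] <= mu D)%E.
  apply: le_measure; rewrite ?inE//.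
  move=> x /=; rewrite in_itv/= le_min => /and3P[x0 xc x1].
  by split; rewrite /= in_itv/= ?x0 ?xc ?x1.
rewrite D0 lebesgue_measure_itv/= lte_fin lt_min c0 ltr01/= -EFinB lee_fin subr0.
by rewrite leNgt lt_min c0 ltr01.
Qed.

Lemma margin_integrable p :
  mu.-integrable `[0, 1] (EFin \o (fun x => (x - p) * f x)).
Proof.
rewrite [X in _.-integrable _ X](_ : _ =
  ((EFin \o (fun x => (x * f x)%R)) \- (fun x => p%:E * (EFin \o f) x))%E).
  apply: integrableB => //; first exact: moment_integrable.
  by apply: integrableZl => //; exact: density_integrable.
by apply/funext => x /=; rewrite mulrBl.
Qed.

Lemma tmoment_condE c : 0 < c ->
  tmoment f `]-oo, c] = condE f `]-oo, c] * tmass f `]-oo, c].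
Proof. by move=> c0; rewrite divfK// gt_eqF// tmass_gt0. Qed.

Lemma bprofit_condE c p : 0 < c ->
  bprofit f `]-oo, c] p = (condE f `]-oo, c] - p) * tmass f `]-oo, c].
Proof. by move=> c0; rewrite bprofitE// tmoment_condE// mulrBl. Qed.

Lemma condE_le c : 0 < c -> condE f `]-oo, c] <= c.
Proof.
move=> c0; have tm := tmass_gt0 _ c0.
rewrite -subr_le0 -(pmulr_lle0 _ tm) -bprofit_condE// /bprofit.
apply: (@le_trans _ _ (\int[mu]_(x in `]-oo, c] `&` `[0%R, 1%R]) 0)).
  apply: le_Rintegral => //.
  - exact: measurableI.
  - apply: integrableS (margin_integrable c) => //; exact: measurableI.
  - exact: integrable0.
  move=> x [/=]; rewrite !in_itv/= => xc x01.
  by rewrite mulr_le0_ge0 ?subr_le0// ltW// density_gt0.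
by rewrite Rintegral_cst ?mul0r//; exact: measurableI.
Qed.

Lemma condE_ge0 c : 0 <= condE f `]-oo, c].
Proof.
have f0 x : (`]-oo, c] `&` `[0, 1]) x -> 0 <= x /\ 0 <= f x.
  move=> [_ /=]; rewrite in_itv/= => x01.
  by split; [case/andP: x01|exact/ltW/density_gt0].
apply: mulr_ge0; last rewrite invr_ge0; apply: Rintegral_ge0 => x /f0[x0 fx] //.
exact: mulr_ge0.
Qed.

(** * Consequences of log-concavity for truncated means *)

Hypothesis lf : strictly_log_concave f.

(** Both [e] and [u + d] lie between [u] and [e + d], as convex combinations with swapped weights
    [t] and [1 - t]. Adding the two concavity inequalities for [ln f] makes the weights
    disappear. *)
Lemma log_concave_cross u e d : 0 <= u -> u <= e -> 0 <= d -> e + d <= 1 ->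
  f u * f (e + d) <= f (u + d) * f e.
Proof.
move=> u0 ue d0 ed.
have [->|ne] := eqVneq u e; first by rewrite mulrC.
have [->|nd] := eqVneq d 0; first by rewrite !addr0 mulrC.
have {ne}ue : u < e by rewrite lt_neqAle ne.
have {nd}d0 : 0 < d by rewrite lt_neqAle eq_sym nd.
have pos : 0 < e + d - u by lra.
pose t := d / (e + d - u).
have t0 : 0 < t by exact: divr_gt0.
have t1 : t < 1 by rewrite ltr_pdivrMr// mul1r; lra.
have u01 : 0 <= u <= 1 by lra.
have ed01 : 0 <= e + d <= 1 by lra.
have uned : u != e + d by rewrite lt_eqF//; lra.
have tE : t * (e + d - u) = d by rewrite divfK// gt_eqF.
have eE : t * u + (1 - t) * (e + d) = e by lra.
have udE : (1 - t) * u + (1 - (1 - t)) * (e + d) = u + d by lra.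
have t01 : 0 < t < 1 by rewrite t0.
have t01' : 0 < 1 - t < 1 by lra.
have := lf _ _ _ u01 ed01 uned t01; rewrite eE.
have := lf _ _ _ u01 ed01 uned t01'; rewrite udE => l1 l2.
have [fu fed] := (density_gt0 _ u01, density_gt0 _ ed01).
have fud : 0 < f (u + d) by apply: density_gt0; lra.
have fe : 0 < f e by apply: density_gt0; lra.
rewrite -ler_ln ?posrE ?mulr_gt0// !lnM ?posrE//; lra.
Qed.

(* With [e] the conditional mean below [x] and [d = y - x], log-concavity makes
   [f (u + d) / f u] decrease in [u], so reweighting by it the density below
   [x] can only lower the mean [e]; the types below [d] are below [e + d]. *)
Lemma condE_lipschitz x y : 0 < x -> x <= y -> y <= 1 ->
  condE f `]-oo, y] <= condE f `]-oo, x] + (y - x).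
Proof.
move=> x0 xy y1; pose e := condE f `]-oo, x]; pose d := y - x.
have e0 : 0 <= e by exact: condE_ge0.
have ex : e <= x by exact: condE_le.
have d0 : 0 <= d by rewrite subr_ge0.
have ed1 : e + d <= 1 by rewrite /d; lra.
have fe : 0 < f e by apply: density_gt0; lra.
have y0 : 0 < y by exact: lt_le_trans xy.
(* Extending the margin by zero to the whole line lets it be translated without tracking the unit
   interval. *)
pose g p := (fun u => (u - p) * f u) \_ `[0, 1].
have gi p : mu.-integrable setT (EFin \o g p).
  exact/extension_integrable/margin_integrable.
have bE c p : bprofit f `]-oo, c] p = \int[mu]_(u in `]-oo, c]) g p u.
  by rewrite /bprofit Rintegral_mkcondr.
have yE : y = x + d by rewrite addrC subrK.
suff: bprofit f `]-oo, x + d] (e + d) <= 0.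
  by rewrite -yE bprofit_condE// pmulr_lle0 ?tmass_gt0// subr_le0.
rewrite bE Rintegral_shift//.
(* [c] is the value at [u = e] of the ratio of [f (u + d)] to [f u]. The ratio is at least [c] where
   the margin [u - e] is negative and at most [c] where it is positive, so replacing it by [c] can
   only raise the integral; by the choice of [e] the result is zero. *)
pose c := f (e + d) / f e.
have c0 : 0 < c by rewrite divr_gt0// density_gt0//; lra.
apply: (@le_trans _ _ (\int[mu]_(u in `]-oo, x]) (c * g e u))).
  apply: le_Rintegral => //.
  - apply: (integrableS measurableT) => //.
    exact: (integrable_shift d _ (gi _)).
  - apply: (integrableS measurableT) => //.
    rewrite [X in _.-integrable _ X](_ : _ =
      (fun u => c%:E * (EFin \o g e) u)%E)//.
    exact: integrableZl.
  move=> u /=; rewrite in_itv/= => ux.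
  have k01 v p : v <= 1 -> g p v = if 0 <= v then (v - p) * f v else 0.
    by move=> v1; rewrite /g patchE mem_setE in_itv/= v1 andbT.
  rewrite !k01; [|lra|lra]; rewrite opprD addrACA subrr addr0.
  have cfe : c * f e = f (e + d) by rewrite divfK// gt_eqF.
  (* Types shifted in from [u < 0] have no counterpart on the right, but they contribute a
     nonpositive margin since [u < 0 <= e]. *)
  have [u0|u0] := leP 0 u; last first.
    rewrite mulr0; case: ifPn => // ud0; rewrite mulr_le0_ge0//; first lra.
    by apply/ltW/density_gt0; lra.
  have ud0 : 0 <= u + d by exact: addr_ge0.
  rewrite ud0 mulrCA.
  have [ue|eu] := leP u e.
    rewrite ler_wnM2l ?subr_le0// -(ler_pM2r fe) mulrAC cfe mulrC.
    exact: log_concave_cross.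
  have {}eu := ltW eu.
  rewrite ler_wpM2l ?subr_ge0// -(ler_pM2r fe) mulrAC cfe mulrC.
  by apply: log_concave_cross => //; lra.
rewrite RintegralZl//; last exact: (integrableS measurableT).
by rewrite -bE bprofit_condE// subrr mul0r mulr0.
Qed.

End density.

(** * Buyers' profit around the laissez-faire price *)

Section market.
Context {R : realType} {f : R -> R} {S theta0 : R}.
Hypotheses (df : is_density f) (lf : strictly_log_concave f).
Hypothesis lc : laissez_faire_cutoff f S theta0.
Local Notation p0 := (condE f `]-oo, theta0]).

(** The Lipschitz bound propagates the equality at [theta0] to a weak inequality above it, and
    uniqueness of the cutoff makes it strict inside the unit interval. *)
Lemma condE_above_cutoff x : theta0 < x -> x <= 1 -> condE f `]-oo, x] < x - S.
Proof.
move: lc => [/andP[t0 t1] [e0 uniq0]].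
have below z : theta0 < z -> z < 1 -> condE f `]-oo, z] < z - S.
  move=> tz z1; rewrite lt_neqAle; apply/andP; split.
    apply/eqP => /esym ez; move: (tz).
    by rewrite (uniq0 z) ?ltxx// z1 (lt_trans t0).
  by have := condE_lipschitz df lf _ _ t0 (ltW tz) (ltW z1); lra.
move=> tx; rewrite le_eqVlt => /predU1P[->|]; last exact: below.
(* Uniqueness is silent at the endpoint 1; strictness is carried there from an interior point by the
   Lipschitz bound. *)
pose m := (theta0 + 1) / 2; have tm : theta0 < m by rewrite /m; lra.
have m1 : m < 1 by rewrite /m; lra.
have := below _ tm m1.
by have := condE_lipschitz df lf _ _ (lt_trans t0 tm) (ltW m1) (lexx 1); lra.
Qed.

Lemma bprofit_p0 : bprofit f `]-oo, theta0] p0 = 0.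
Proof. by rewrite bprofit_condE ?subrr ?mul0r//; case: lc => /andP[]. Qed.

Lemma bprofit_gt_p0 p : p0 < p -> bprofit f `]-oo, p + S] p < 0.
Proof.
move: (lc) => [/andP[t0 t1] [e0 _]] pp.
have tpS : theta0 < p + S by lra.
(* No type exceeds 1, so truncating the cutoff leaves profit unchanged and brings it into the range
   of [condE_above_cutoff]. *)
pose x := Num.min (p + S) 1.
have xt : theta0 < x by rewrite lt_min tpS.
have -> : bprofit f `]-oo, p + S] p = bprofit f `]-oo, x] p.
  congr Rintegral; apply/seteqP; split => u [/= + u01]; rewrite !in_itv/= => ux;
    (split; last exact: u01); move: u01; rewrite /= !in_itv/= => /andP[_ u1].
    by rewrite le_min ux.
  by move: ux; rewrite le_min => /andP[].
have x0 : 0 < x by exact: lt_trans xt.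
have x1 : x <= 1 by rewrite ge_min lexx orbT.
have xpS : x <= p + S by rewrite ge_min lexx.
rewrite bprofit_condE// pmulr_llt0 ?tmass_gt0//.
by have := condE_above_cutoff _ xt x1; lra.
Qed.

End market.

(** * Optimal choices of a firm in each period *)

Section best_reply.
Context {R : realType}.

(** The payoff jumps by [S] at the price [I], but once [pg] funds the project a price below [I]
    loses on both counts. *)
Lemma lt_sale_payoff (I S pg p : R) : 0 < S -> I <= pg ->
  (sale_payoff I S pg < sale_payoff I S p) = (pg < p).
Proof.
move=> S0 Ipg; rewrite /sale_payoff Ipg; case: ifPn => [Ip|].
  by rewrite ltrD2r.
by rewrite -ltNge => pI; apply/idP/idP; lra.
Qed.

Lemma u2_best (I S theta p : R) (s : bool) :
  (forall b, u2 I S theta b p <= u2 I S theta s p) ->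
  theta != sale_payoff I S p -> s <-> theta < sale_payoff I S p.
Proof.
move=> best nt; split.
  by move=> sT; have := best false; rewrite sT /= le_eqVlt (negbTE nt).
move=> lt; apply: contraT => /negbTE sF.
by have := best true; rewrite sF /= leNgt lt.
Qed.

End best_reply.

Section period1.
Context {R : realType} {I S delta pg p2 : R} {sigma1 : R -> R -> act1}
  {sigma2 : R -> act1 -> R -> bool}.
Hypothesis best2 : forall theta a p b, 0 <= theta <= 1 ->
  u2 I S theta b p <= u2 I S theta (sigma2 theta a p) p.

(** [sigma2] may condition on the firm's own past action, yet both continuations are optimal at the
    same price [p2]; their values coincide and the discounted terms cancel. *)
Lemma U1B theta a a' p : 0 <= theta <= 1 ->
  U1 I S pg delta p2 sigma2 theta a p - U1 I S pg delta p2 sigma2 theta a' p =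
  u1 I S pg theta a p - u1 I S pg theta a' p.
Proof.
move=> t01; rewrite /U1.
have -> : u2 I S theta (sigma2 theta a p2) p2 =
          u2 I S theta (sigma2 theta a' p2) p2.
  by apply/le_anti; rewrite !best2.
by ring.
Qed.

Lemma U1_le theta a a' p : 0 <= theta <= 1 ->
  (U1 I S pg delta p2 sigma2 theta a p <= U1 I S pg delta p2 sigma2 theta a' p)
  = (u1 I S pg theta a p <= u1 I S pg theta a' p).
Proof. by move=> t01; rewrite -subr_le0 U1B// subr_le0. Qed.

Lemma U1_lt theta a a' p : 0 <= theta <= 1 ->
  (U1 I S pg delta p2 sigma2 theta a p < U1 I S pg delta p2 sigma2 theta a' p)
  = (u1 I S pg theta a p < u1 I S pg theta a' p).
Proof. by move=> t01; rewrite -subr_lt0 U1B// subr_lt0. Qed.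

End period1.

(** * Existence and outcome of equilibrium *)

Section secret_bailout.
Context {R : realType} {f : R -> R} {I S theta0 pg delta : R}.
Hypotheses (df : is_density f) (lf : strictly_log_concave f) (S0 : 0 < S).
Hypothesis lc : laissez_faire_cutoff f S theta0.
Local Notation p0 := (condE f `]-oo, theta0]).
Hypotheses (Ip0 : I <= p0) (p0pg : p0 < pg).

Let Ipg : I <= pg. Proof. exact: le_trans (ltW p0pg). Qed.

Let sale_payoffE p : I <= p -> sale_payoff I S p = p + S.
Proof. by rewrite /sale_payoff => ->. Qed.

Let sale_payoff_p0 : sale_payoff I S p0 = theta0.
Proof. by rewrite sale_payoffE//; case: lc => _ [<- _]; rewrite subrK. Qed.

Lemma secret_bailout_eq_exists :
  exists p1 p2 sigma1 sigma2,
    secret_bailout_eq f I S delta pg p1 p2 sigma1 sigma2.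
Proof.
pose sigma1 theta p := if pg < p then if theta < p + S then Mkt else Keep
  else if theta < pg + S then Gov else Keep.
pose sigma2 theta (a : act1) p := theta < sale_payoff I S p.
have best2 theta a p b : 0 <= theta <= 1 ->
    u2 I S theta b p <= u2 I S theta (sigma2 theta a p) p.
  by move=> _; rewrite /u2 /sigma2; case: b; case: ltP => // /ltW.
(* At market price [pg] the tie goes to the government, so nobody sells to the market and buyers
   break even on an empty set. Any higher offer draws all types below that price plus [S] and loses
   money. *)
exists pg, p0, sigma1, sigma2; split=> //; split; last split; last split.
- move=> theta p a t01; rewrite (U1_le best2)// /sigma1 /u1 (sale_payoffE _ Ipg).
  case: ltP => [pgp|ppg].
    rewrite sale_payoffE; last exact: le_trans (ltW pgp).
    by case: a; case: ltP => //; lra.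
  have : sale_payoff I S p <= pg + S.
    by rewrite -(sale_payoffE _ Ipg) leNgt lt_sale_payoff// -leNgt.
  by case: a; case: ltP => //; lra.
- move=> theta p t01; rewrite (U1_lt best2)// /sigma1 /u1 lt_sale_payoff//.
  by case: ltP => // _; case: ltP.
- split; last first.
    move=> p' pgp'; left; rewrite (bprofit_cutoff df _ (p' + S)).
      exact: (bprofit_gt_p0 df lf lc _ (lt_trans p0pg pgp')).
    by move=> x _ _; rewrite /sellers1 /sigma1 /= pgp'; case: ltP.
  rewrite /bprofit (_ : sellers1 _ _ = set0) ?set0I ?Rintegral_set0//.
  by apply/seteqP; split => x //=; rewrite /sellers1 /sigma1 /= ltxx; case: ltP.
- have cut p x : 0 <= x <= 1 -> x != sale_payoff I S p ->
    sellers2 sigma1 sigma2 pg p x <-> x < sale_payoff I S p by [].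
  split.
    rewrite (bprofit_cutoff df _ _ _ (cut p0)) sale_payoff_p0.
    exact: bprofit_p0 df lc.
  move=> p' p0p'; left; rewrite (bprofit_cutoff df _ _ _ (cut p')).
  rewrite sale_payoffE; last exact: le_trans (ltW p0p').
  exact: (bprofit_gt_p0 df lf lc).
Qed.

Lemma secret_bailout_eq_outcome p1 p2 sigma1 sigma2 :
  secret_bailout_eq f I S delta pg p1 p2 sigma1 sigma2 ->
  p2 = p0 /\
  (forall theta, 0 <= theta <= 1 -> theta != pg + S ->
     (sigma1 theta p1 = Gov <-> theta < pg + S)) /\
  (forall theta, 0 <= theta <= 1 -> theta != theta0 ->
     (sigma2 theta (sigma1 theta p1) p2 <-> theta < theta0)).
Proof.
move=> [best2 [best1 [tie [[zero1 _] [zero2 undercut2]]]]].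
have cut2 p x : 0 <= x <= 1 -> x != sale_payoff I S p ->
    sellers2 sigma1 sigma2 p1 p x <-> x < sale_payoff I S p.
  by move=> x01; apply: u2_best => b; exact: best2.
have p2E : p2 = p0.
  (* Below [p0], a rival could offer [p0] and break even on a positive mass of sellers, which
     Bertrand pricing forbids; above [p0], buyers make a strict loss instead of breaking even. *)
  have [p2p0|p0p2|//] := ltgtP p2 p0.
    have [] := undercut2 _ p2p0.
      rewrite (bprofit_cutoff df _ _ _ (cut2 p0)) sale_payoff_p0.
      by rewrite (bprofit_p0 df lc) ltxx.
    rewrite (tmass_cutoff df _ _ (cut2 p0)) sale_payoff_p0 => tm0.
    have : 0 < theta0 by case: lc => /andP[].
    by move/(tmass_gt0 df); rewrite tm0 ltxx.
  have := bprofit_gt_p0 df lf lc _ p0p2.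
  rewrite -(sale_payoffE p2); last exact: le_trans (ltW p0p2).
  by rewrite -(bprofit_cutoff df _ _ _ (cut2 p2)) zero2 ltxx.
have u1_best x a : 0 <= x <= 1 ->
    u1 I S pg x a p1 <= u1 I S pg x (sigma1 x p1) p1.
  by move=> x01; rewrite -(U1_le (delta := delta) (p2 := p2) best2)// best1.
(* A market price above [pg] would beat the government for every seller, hence attract all types
   below [p1 + S] at a strict loss. *)
have p1pg : p1 <= pg.
  rewrite leNgt; apply/negP => pgp1.
  have Ip1 : I <= p1 by exact: le_trans (ltW pgp1).
  have := bprofit_gt_p0 df lf lc _ (lt_trans p0pg pgp1).
  rewrite -(bprofit_cutoff df (sellers1 sigma1 p1)) ?zero1 ?ltxx// => x x01 xp1.
  move: (u1_best x Gov x01) (u1_best x Mkt x01) (u1_best x Keep x01).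
  rewrite /sellers1 /=.
  case: (sigma1 x p1); rewrite /= !sale_payoffE// => g m k; split=> //.
  - by exfalso; lra.
  - by rewrite lt_neqAle xp1.
  - by rewrite ltNge m.
split=> //; split=> [theta t01 tpg|theta t01 tt0]; last first.
  have := cut2 p2 theta t01.
  by rewrite {1 3}p2E sale_payoff_p0; exact.
(* With [p1 <= pg], selling to the market is never strictly better than the government, so
   tie-breaking excludes it. *)
have := tie theta p1 t01; rewrite (U1_lt best2)// /u1 lt_sale_payoff// ltNge p1pg.
move: (u1_best _ Gov t01) (u1_best _ Keep t01).
case: (sigma1 theta p1); rewrite /= sale_payoffE// => g k mk; split=> //.
- by rewrite lt_neqAle tpg.
- by have := mk erefl.
- by rewrite ltNge g.
Qed.

End secret_bailout.

Theorem theorem2 (R : realType) (f : R -> R) (I S theta0 pg : R) :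
  is_density f -> strictly_log_concave f -> monotone_condition f ->
  0 < I -> 0 < S ->
  laissez_faire_cutoff f S theta0 ->
  I <= condE f `]-oo, theta0] ->
  condE f `]-oo, theta0] < pg ->
  exists delta_bar : R, delta_bar < 1 /\
  forall delta : R, delta_bar < delta -> delta < 1 ->
    (exists p1 p2 sigma1 sigma2,
        secret_bailout_eq f I S delta pg p1 p2 sigma1 sigma2) /\
    (forall p1 p2 sigma1 sigma2,
        secret_bailout_eq f I S delta pg p1 p2 sigma1 sigma2 ->
        p2 = condE f `]-oo, theta0] /\
        (forall theta, 0 <= theta <= 1 -> theta != pg + S ->
           (sigma1 theta p1 = Gov <-> theta < pg + S)) /\
        (forall theta, 0 <= theta <= 1 -> theta != theta0 ->
           (sigma2 theta (sigma1 theta p1) p2 <-> theta < theta0))).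
Proof.
(* Continuation values cancel for every discount factor, so any bound below 1 serves as
   [delta_bar]. *)
move=> df lf _ _ S0 lc Ip0 p0pg; exists 0; split; first exact: ltr01.
move=> delta _ _; split; first exact: secret_bailout_eq_exists df lf S0 lc Ip0 p0pg.
move=> p1 p2 sigma1 sigma2.
exact: secret_bailout_eq_outcome df lf S0 lc Ip0 p0pg _ _ _ _.
Qed.
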